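(* The achromatic index of the Johnson graph $J(n,2)$ satisfies $$ \alpha_2(J(3,2))=3,\qquad \alpha_2(J(4,2))=7,\qquad \alpha_2(J(5,2))=15. $$ Moreover, with $f=f_n$ and $U(n)$ as defined in the context: (1) if $n\geq 7$ is odd, then $$n(n-2)=f\left(\frac{n-1}{2}\right)\leq\alpha_2(J(n,2))\leq U(n);$$ (2) if $n\geq 6$ is even and $n\not\equiv 0\pmod{6}$, then $$n(n-3)+2=f\left(\frac{n}{2}\right)\leq\alpha_2(J(n,2))\leq U(n);$$ (3) if $n\geq 6$ and $n\equiv 0\pmod{6}$, then $$n(n-3)+3=f\left(\frac{n}{2}\right)+1\leq\alpha_2(J(n,2))\leq U(n).$$
   Context: All graphs are finite, simple and undirected. The Johnson graph $J(n,2)$ has as vertices the $2$-subsets of an $n$-element set, two vertices being adjacent if and only if their intersection has size exactly $1$. Two (distinct) edges of a graph are incident if they share a common vertex. A $t$-edge-coloring of a graph $G$ is a mapping $\varphi:E(G)\to\{1,2,\ldots,t\}$; it induces a partition of $E(G)$ into the color classes $\varphi^{-1}(i)$, $i\in\{1,\ldots,t\}$. It is proper if no two incident edges receive the same color, and complete if for every pair of distinct colors $i,j\in\{1,\ldots,t\}$ there exist two incident edges, one of color $i$ and one of color $j$. The achromatic index $\alpha_2(G)$ is the largest integer $t$ for which $G$ admits a proper and complete $t$-edge-coloring. For $n\ge 3$ and positive integers $x$, let $$ f(x)=f_n(x)=\left\lfloor\frac{\binom{n}{2}(n-2)}{x}\right\rfloor, \qquad g(x)=g_n(x)=4nx-10x+1.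 $$ Let $$ x_0=x_0(n):=-\frac{1}{8n-20}+\frac12\sqrt{\frac{n^2}{2}-\frac n4+\frac38+\frac{\frac{15n}{4}-\frac{73}{8}}{4n^2-20n+25}}, $$ and define $$ U(n):=\max\left\{\min\{f(\lfloor x_0\rfloor),g(\lfloor x_0\rfloor)\},\ \min\{f(\lceil x_0\rceil),g(\lceil x_0\rceil)\}\right\}. $$ *)

(* Defs.v *)
From mathcomp Require Import all_boot all_order all_algebra.
From mathcomp Require Import reals.

Set Implicit Arguments.
Unset Strict Implicit.
Unset Printing Implicit Defensive.

Import Order.TTheory GRing.Theory Num.Theory.

Record sgraph := SGraph {
  vertex :> finType;
  adj : rel vertex;
  adj_sym : symmetric adj;
  adj_irr : irreflexive adj }.

Definition edge_set (G : sgraph) : {set {set G}} :=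
  [set [set p.1; p.2] | p : G * G & adj p.1 p.2].

Notation edge G := {e : {set vertex G} | e \in edge_set G}.

Definition incident (G : sgraph) (e e' : edge G) : bool :=
  (e != e') && (val e :&: val e' != set0).

Definition proper_coloring (G : sgraph) (t : nat) (c : {ffun edge G -> 'I_t}) : bool :=
  [forall e, forall e', incident e e' ==> (c e != c e')].

Definition complete_coloring (G : sgraph) (t : nat) (c : {ffun edge G -> 'I_t}) : bool :=
  [forall i, forall j, (i != j) ==>
     [exists e, exists e', [&& incident e e', c e == i & c e' == j]]].

Definition has_pc_coloring (G : sgraph) (t : nat) : bool :=
  [exists c : {ffun edge G -> 'I_t}, proper_coloring c && complete_coloring c].

(* The bound on [t] excludes nothing: for [t >= 2] a complete coloring uses
   every color.  See [achromatic_indexP]. *)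
Definition achromatic_index (G : sgraph) : nat :=
  \max_(t < #|edge_set G|.+2 | has_pc_coloring G t) t.

Lemma card_edge (G : sgraph) : #|{: edge G}| = #|edge_set G|.
Proof. by rewrite card_sig; apply: eq_card. Qed.

Lemma has_pc_coloring_bound (G : sgraph) (t : nat) :
  has_pc_coloring G t -> t <= #|edge_set G|.+1.
Proof.
case: t => [|[|t]] // /existsP[c /andP[_ /forallP cc]].
have surj (i : 'I_t.+2) : i \in codom c.
  have [j nij] : exists j : 'I_t.+2, i != j.
    by exists (lift i ord0); apply: neq_lift.
  move/forallP/(_ j): (cc i); rewrite nij => /existsP[e /existsP[e' /and3P[_ /eqP<- _]]].
  exact: codom_f.
have : #|'I_t.+2| <= #|codom c|.
  by apply/subset_leq_card/subsetP => i _; apply: surj.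
rewrite card_ord => /leq_trans -> //.
apply: leq_trans (leq_image_card _ _) _.
by rewrite card_edge leqnSn.
Qed.

Lemma has_pc_coloring_ex (G : sgraph) : exists t, has_pc_coloring G t.
Proof.
pose P t := [exists c : {ffun edge G -> 'I_t}, proper_coloring c].
have exP : exists t, P t.
  exists #|{: edge G}|; apply/existsP; exists [ffun e => enum_rank e].
  apply/forallP => e; apply/forallP => e'; apply/implyP => /andP[ne _].
  by rewrite !ffunE (inj_eq enum_rank_inj).
case: (ex_minnP exP) => t /existsP[c pc] mint.
exists t; apply/existsP; exists c; rewrite pc /=.
apply/forallP => i; apply/forallP => j; apply/implyP => nij.
apply: contraT => nex.
have nex2 e e' : incident e e' -> c e = i -> c e' = j -> False.
  move=> inc ei ej; case/negP: nex; apply/existsP; exists e; apply/existsP.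
  by exists e'; rewrite inc ei ej !eqxx.
case: t => [|t] in c pc mint i j nij nex nex2 *; first by case: i nij nex nex2.
have [i' i'E] : exists i', i = lift j i'.
  by case: (unliftP j i) => [i' ->|ij]; [exists i' | rewrite ij eqxx in nij].
have : P t; last by move/mint; rewrite ltnn.
apply/existsP; exists [ffun e => odflt i' (unlift j (c e))].
apply/forallP => e; apply/forallP => e'; apply/implyP => inc; rewrite !ffunE.
have inc' : incident e' e by rewrite /incident eq_sym setIC.
move/forallP/(_ e)/forallP/(_ e'): pc; rewrite inc /=.
case: (unliftP j (c e)) => [a|] ea; case: (unliftP j (c e')) => [b|] eb;
  rewrite ea eb ?eqxx // => nab /=.
- by apply: contraNneq nab => ->.
- by apply/eqP => ai; apply: (nex2 e e'); rewrite // ea ai.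
- by apply/eqP => bi; apply: (nex2 e' e); rewrite // eb -bi.
Qed.

Lemma achromatic_indexP (G : sgraph) :
  has_pc_coloring G (achromatic_index G) /\
  (forall t, has_pc_coloring G t -> t <= achromatic_index G).
Proof.
have [t Ht] := has_pc_coloring_ex G; split.
  have t0 : t < #|edge_set G|.+2 := has_pc_coloring_bound Ht.
  by rewrite /achromatic_index (bigop.bigmax_eq_arg (Ordinal t0)) //; case: arg_maxnP.
move=> s Hs; have s0 : s < #|edge_set G|.+2 := has_pc_coloring_bound Hs.
exact: (@leq_bigmax_cond _ (fun t : 'I_ _ => has_pc_coloring G t)
         (fun t : 'I_ _ => t : nat) (Ordinal s0)).
Qed.

Notation johnson_vertex n := {A : {set 'I_n} | #|A| == 2}.

Definition johnson_adj (n : nat) : rel (johnson_vertex n) :=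
  fun A B => #|val A :&: val B| == 1.

Lemma johnson_adj_sym (n : nat) : symmetric (@johnson_adj n).
Proof. by move=> A B; rewrite /johnson_adj setIC. Qed.

Lemma johnson_adj_irr (n : nat) : irreflexive (@johnson_adj n).
Proof. by move=> A; rewrite /johnson_adj setIid (eqP (valP A)). Qed.

Definition johnson2 (n : nat) : sgraph :=
  SGraph (@johnson_adj_sym n) (@johnson_adj_irr n).

Local Open Scope ring_scope.

(* For positive [x], Euclidean division of integers is the floor of the quotient. *)
Definition f (n : nat) (x : int) : int :=
  (('C(n, 2)%:Z * (n%:Z - 2)) %/ x)%Z.

Definition g (n : nat) (x : int) : int := 4 * n%:Z * x - 10 * x + 1.

Definition x0 (R : realType) (n : nat) : R :=
  - (1 / (8 * n%:R - 20)) +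
  1 / 2 * Num.sqrt (n%:R ^+ 2 / 2 - n%:R / 4 + 3 / 8 +
                    (15 * n%:R / 4 - 73 / 8) / (4 * n%:R ^+ 2 - 20 * n%:R + 25)).

Definition U (R : realType) (n : nat) : int :=
  let lo := Num.floor (x0 R n) in
  let hi := Num.ceil (x0 R n) in
  Num.max (Num.min (f n lo) (g n lo)) (Num.min (f n hi) (g n hi)).

(* Main.v *)
Require Import Defs.
From mathcomp Require Import all_boot all_order all_algebra.
From mathcomp Require Import reals zify ring lra.

(** An edge of J(n,2) joins two pairs {a,x} and {a,y} of K_n: it is a cherry,
with center [a] and leaves [x], [y].  A proper edge-coloring of J(n,2) is a
coloring of the cherries of K_n in which two cherries that share an edge of
K_n differ in color, and it is complete when any two color classes cover a
common edge of K_n.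

Upper bound.  Let [t] be the number of colors and [x] the size of a smallest
color class.  Counting all edges gives [t <= f x].  Every other color occurs
on an edge incident to one of the [x] edges of that class, and an edge of
J(n,2) has at most 4n-10 incident edges, so [t <= g x]
([smallest_class_bounds]).  Since [x0] is the positive root of the equation
expressing that the real versions of [f] and [g] agree ([x0_root]), and [f]
decreases while [g] increases, the best [x] is one of the two integers around
[x0], which gives [U] ([le_U]).

Lower bound, [n] odd.  Pairs of leaves of cherries centered at [a] are edges
of the complete graph on the other n-1 vertices, which has a 1-factorization
into n-2 perfect matchings; one color per center and per matching.  Each color
class covers the full star of K_n at its center, and two stars always share an
edge ([achromatic_odd_ge]).

Lower bound, [n] even.  Now n-1 is odd, and the pairs of leaves at a center
[b] split into n-1 near-perfect matchings, each missing one vertex; a color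
given by the matching that misses [c] covers the star at [b] except for the
edge [bc].  At each center [b] the two matchings missing [b-2] and [b+2] are
dissolved.  Their union is a Hamiltonian path from [b-2] to [b+2] on the
vertices other than [b], arranged so that [b-1] and [b+1] are consecutive
on it.  Removing the pair {b-1,b+1} cuts the path in two, and each
remaining pair can be assigned to its end that is farther from the end
[b-2] or [b+2] of its piece.  In this way every vertex [a] other than [b-2]
and [b+2] gets exactly one pair, say {a,y}, and the cherry with center [b]
and leaves [a], [y] receives the color at the center [a] whose matching
misses [b]: it supplies the missing edge [ab].  That color exists because the
relation of being at distance 2 is symmetric.  So n(n-3) colors cover full
stars, and the [n] cherries with center [b] and leaves [b-1], [b+1] remain.
They are split by the residue of [b] modulo 2, or modulo 3 if 6 divides [n],
into two or three further colors.  Each of these reaches every vertex, hence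
meets every star, and any two of them share some edge {b,b+1}
([achromatic_even_ge]).

For n = 3 and n = 5 the odd construction meets the counting bounds; for n = 4
an explicit coloring of the octahedron with 7 colors does. *)

Set Implicit Arguments.
Unset Strict Implicit.
Unset Printing Implicit Defensive.

Import Order.TTheory GRing.Theory Num.Theory.

(** * Adjacency in the Johnson graph *)

Lemma johnson_vertex_mem n (A : johnson2 n) a : a \in val A ->
  exists2 x, x != a & val A = [set a; x].
Proof.
move=> aA; have := cardsD1 a (val A); rewrite aA (eqP (valP A)) => -[].
move=> /esym/eqP/cards1P[x Ax]; exists x; last by rewrite -Ax setD1K.
by have := set11 x; rewrite -Ax !inE => /andP[].
Qed.

Lemma johnson_adjP n (A B : johnson2 n) : adj A B ->
  exists a x y, [/\ uniq [:: a; x; y], val A = [set a; x] & val B = [set a; y]].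
Proof.
move=> /cards1P[a ABa].
have /andP[aA aB] : (a \in val A) && (a \in val B) by rewrite -in_setI ABa set11.
have [[x xa Ax] [y ya By]] := (johnson_vertex_mem aA, johnson_vertex_mem aB).
exists a, x, y; split=> //; rewrite /= !inE negb_or andbT ![a == _]eq_sym xa ya /=.
apply: contraNneq xa => xy; have: x \in [set a] by rewrite -ABa Ax By xy setIid set22.
by rewrite inE.
Qed.

(** * Counting bounds from a smallest color class *)

(** Each end of [e] lies on at most [D - 1] edges other than [e]. *)
Lemma card_incident_le (G : sgraph) D (e : edge G) :
  (forall v : G, #|[set w | adj v w]| <= D) ->
  #|[set e' | incident e e']| <= (D - 1).*2.
Proof.
move=> degD; case/imsetP: (valP e) => -[A B] /=; rewrite inE /= => AB eAB.
pose N (v w : G) := [set [set v; u] | u in [set u | adj v u] :\ w].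
have cN v w : adj v w -> #|N v w| <= D - 1.
  move=> vw; apply: leq_trans (leq_imset_card _ _) _.
  by have := degD v; rewrite (cardsD1 w) inE vw; lia.
rewrite -(card_imset _ val_inj) -addnn.
apply: leq_trans (leq_add (cN _ _ AB) (cN B A _)); last by rewrite adj_sym.
apply: leq_trans (leq_card_setU _ _).1; apply: subset_leq_card.
apply/subsetP=> _ /imsetP[e' + ->]; rewrite inE => /andP[nee' /set0Pn[v]].
case/setIP=> ve ve'.
have {}ve : v \in [set A; B] by rewrite -eAB.
case/imsetP: (valP e') => -[a b] /=; rewrite inE /= => ab e'ab.
have [u vu e'vu] : exists2 u, adj v u & val e' = [set v; u].
  have: v \in [set a; b] by rewrite -e'ab.
  rewrite !inE => /orP[]/eqP->; first by exists b.
  by exists a; rewrite 1?adj_sym // setUC.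
case/set2P: ve => ve; subst v; apply/setUP; [left|right]; rewrite e'vu; apply: imset_f;
  rewrite !inE vu andbT; apply: contraNneq nee' => ?; subst u; apply/eqP/val_inj;
  by rewrite /= eAB e'vu // setUC.
Qed.

(** The witness is the size of a smallest color class.  It is positive because
with at least two colors completeness makes every color occur. *)
Lemma smallest_class_bounds (G : sgraph) D t :
  (forall v : G, #|[set w | adj v w]| <= D) -> 1 < t -> has_pc_coloring G t ->
  exists x, [/\ 0 < x, t * x <= #|edge_set G| & t <= x * (D - 1).*2 + 1].
Proof.
move=> degD t1 /existsP[c /andP[_ /forallP cc]].
case: t => // t in t1 c cc *.
pose K i := [set e | c e == i].
have [i _ Kmin] := arg_minnP (fun i => #|K i|) (isT : predT (@ord0 t)).
have ccP j k : j != k -> exists e e', [/\ incident e e', c e = j & c e' = k].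
  move=> njk; move/forallP/(_ k): (cc j); rewrite njk => /existsP[e /existsP[e']].
  by case/and3P=> ? /eqP ? /eqP ?; exists e, e'.
exists #|K i|; split.
- have [j] : exists j : 'I_t.+1, i != j.
    case: t t1 {c cc K Kmin ccP} i => // t _ i.
    by exists (lift i ord0); apply: neq_lift.
  by case/ccP=> e [_ [_ ci _]]; apply/card_gt0P; exists e; rewrite inE ci.
- have -> : #|edge_set G| = \sum_(j < t.+1) #|K j|.
    rewrite -card_edge -sum1_card (partition_big c predT) //=.
    by apply: eq_bigr => j _; rewrite sum1dep_card.
  rewrite -[X in X * _](card_ord t.+1) -sum_nat_const.
  by apply: leq_sum => j _; apply: Kmin.
rewrite -[X in X <= _](card_ord t.+1) (cardD1 i) inE addnC leq_add2r.
pose I := \bigcup_(e in K i) [set e' | incident e e'].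
apply: (@leq_trans #|c @: I|).
  apply/subset_leq_card/subsetP=> j; rewrite !inE andbT eq_sym => nij.
  have [e [e' [ee' ce <-]]] := ccP _ _ nij; apply: imset_f.
  by apply/bigcupP; exists e; rewrite inE ?ce.
apply: leq_trans (leq_imset_card _ _) _.
rewrite /I -sum_nat_const.
elim/big_rec2: _ => [|e s T _ IH]; first by rewrite cards0.
apply: leq_trans (leq_card_setU _ _).1 _.
by rewrite leq_add // card_incident_le.
Qed.

Lemma johnson2_degree n (A : johnson2 n) : #|[set B : johnson2 n | adj A B]| <= (n - 2).*2.
Proof.
have cA : #|val A| = 2 by apply/eqP; apply: valP A.
rewrite -(card_imset _ val_inj) -mul2n -[X in X * _]cA.
have -> : n - 2 = #|~: val A| by rewrite cardsCs setCK cA card_ord.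
(* A neighbor of A is a point of A together with a point outside A. *)
rewrite -cardsX; apply: leq_trans (leq_imset_card (fun p => [set p.1; p.2]) _).
apply/subset_leq_card/subsetP=> _ /imsetP[B + ->]; rewrite inE => /johnson_adjP.
case=> a [x [y [axy Ax By]]]; apply/imsetP; exists (a, y); rewrite //= !inE /=.
move: axy; rewrite /= !inE negb_or andbT Ax !inE eqxx => /andP[/andP[_ ay] xy] /=.
by rewrite negb_or ![y == _]eq_sym ay xy.
Qed.

Lemma johnson2_size n : #|edge_set (johnson2 n)| <= 'C(n, 2) * (n - 2).
Proof.
(* Every edge is a cherry, which is given by its pair of leaves and its center. *)
pose T := [set p : {set 'I_n} * 'I_n | (#|p.1| == 2) && (p.2 \notin p.1)].
have <- : #|T| = 'C(n, 2) * (n - 2).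
  rewrite -sum1dep_card -(pair_big_dep (fun P : {set 'I_n} => #|P| == 2)
    (fun (P : {set 'I_n}) x => x \notin P) (fun _ _ => 1)) /=.
  rewrite -[X in 'C(X, 2)]card_ord -card_draws -sum1dep_card big_distrl /=.
  apply: eq_bigr => P /eqP cP; rewrite mul1n sum1dep_card.
  rewrite -[X in X - 2](card_ord n) -cP -(cardsC P) addKn.
  by apply: eq_card => x; rewrite !inE.
pose h (p : {set 'I_n} * 'I_n) : {set johnson2 n} :=
  [set A : johnson2 n | [exists x in p.1, val A == [set p.2; x]]].
apply: leq_trans (leq_imset_card h _).
apply/subset_leq_card/subsetP=> _ /imsetP[[A B] + ->]; rewrite inE /=.
move=> /johnson_adjP[a [x [y [axy Ax By]]]].
move: axy; rewrite /= !inE negb_or andbT => /andP[/andP[ax ay] xy].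
apply/imsetP; exists ([set x; y], a).
  by rewrite !inE /= cards2 xy /= negb_or ax ay.
apply/setP=> F; rewrite !inE; apply/orP/existsP=> /=.
  by case=> /eqP->; [exists x|exists y]; rewrite !inE ?eqxx ?orbT /= -?Ax -?By.
case=> z /andP[]; rewrite !inE => /orP[]/eqP-> /eqP Fz; [left|right].
  by apply/eqP/val_inj; rewrite /= Fz -Ax.
by apply/eqP/val_inj; rewrite /= Fz -By.
Qed.

Lemma achromatic_smallest_class n : 1 < achromatic_index (johnson2 n) ->
  exists x, [/\ 0 < x, achromatic_index (johnson2 n) * x <= 'C(n, 2) * (n - 2)
              & achromatic_index (johnson2 n) <= x * (4 * n - 10) + 1].
Proof.
move=> t1; have [pc _] := achromatic_indexP (johnson2 n).
have [x [x0 tE tI]] := smallest_class_bounds (@johnson2_degree n) t1 pc.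
exists x; split=> //; first exact: leq_trans tE (johnson2_size n).
by rewrite (leq_trans tI) // leq_add2r leq_mul2l; apply/orP; right; lia.
Qed.

Section UpperBound.
Local Open Scope ring_scope.

(** With [B = 4n - 10], the radicand in [x0] is [(1 + 4 B F) / B^2] for
[F = n(n-1)(n-2)/2], so that [x0] is the nonnegative root of [B x^2 + x = F]. *)
Lemma x0_root (R : realType) (n : nat) : (3 <= n)%N ->
  0 <= x0 R n /\
  (4 * n%:R - 10) * x0 R n ^+ 2 + x0 R n = ('C(n, 2) * (n - 2))%:R.
Proof.
move=> n3; have [m mE] : exists m, n = m.+3 by exists (n - 3)%N; lia.
have binE : ('C(n, 2) * (n - 2))%:R = n%:R * (n%:R - 1) * (n%:R - 2) / 2 :> R.
  have /esym := mul_bin_diag n 1; rewrite mE bin1.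
  move=> /(congr1 (fun k => k%:R : R)); rewrite !natrM => e.
  have -> : 'C(m.+3, 2)%:R = m.+3%:R * m.+2%:R / 2 :> R by rewrite -e; field.
  have -> : (m.+3 - 2)%N = m.+1 by lia.
  by rewrite -![in RHS]natr1 -![in LHS]natr1; field.
rewrite {}binE /x0; have : 3 <= n%:R :> R by rewrite (ler_nat R 3).
move: (n%:R : R) => N N3.
set q := (X in Num.sqrt X); set s := Num.sqrt q.
have qE : q = (1 + 2 * (4 * N - 10) * (N * (N - 1) * (N - 2))) / (4 * N - 10) ^+ 2.
  by rewrite /q; field; apply/andP; split; apply: lt0r_neq0; nra.
have P0 : 0 <= N * (N - 1) * (N - 2) by rewrite !mulr_ge0 //; lra.
have q0 : 0 <= q by rewrite qE divr_ge0 ?sqr_ge0 //; nra.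
have s2 : s ^+ 2 = q by rewrite sqr_sqrtr.
have s0 : 0 <= s by exact: sqrtr_ge0.
have B0 : 0 < 4 * N - 10 by lra.
have Bs : 1 <= (4 * N - 10) * s.
  have B0' := ltW B0.
  rewrite -(@ler_pXn2r _ 2) // ?nnegrE ?mulr_ge0 // exprMn s2 qE expr1n.
  by rewrite mulrC divfK ?lt0r_neq0 ?exprn_gt0 //; nra.
have -> : 8 * N - 20 = 2 * (4 * N - 10) by ring.
have xE : - (1 / (2 * (4 * N - 10))) + 1 / 2 * s = ((4 * N - 10) * s - 1) / (2 * (4 * N - 10)).
  by field; apply: lt0r_neq0.
rewrite xE; split; first by rewrite divr_ge0 //; lra.
have -> : (4 * N - 10) * (((4 * N - 10) * s - 1) / (2 * (4 * N - 10))) ^+ 2 +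
   ((4 * N - 10) * s - 1) / (2 * (4 * N - 10)) = ((4 * N - 10) ^+ 2 * s ^+ 2 - 1) / (4 * (4 * N - 10)).
  by field; apply: lt0r_neq0.
by rewrite s2 qE; field; apply: lt0r_neq0.
Qed.

(** Let [F = n(n-1)(n-2)/2].  If [x] is at most [x0], then [g x <= g lo] for
[lo] the floor of [x0], and [g lo * lo <= F] because [lo] is at most the root.
If [x] exceeds [x0], the ceiling [hi] of [x0] is at most [x]; then
[t * hi <= F], and [F <= g hi * hi] because [hi] is at least the root. *)
Lemma le_U (R : realType) (n t x : nat) : (3 <= n)%N -> (0 < x)%N ->
  (t * x <= 'C(n, 2) * (n - 2))%N -> (t <= x * (4 * n - 10) + 1)%N ->
  t%:Z <= U R n.
Proof.
move=> n3 x_gt0 tf tg.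
have [x0_ge0 x0E] := x0_root R n3.
have N3 : 3 <= n%:R :> R by rewrite (ler_nat R 3).
have fP (z : int) : 0 < z -> t%:Z * z <= ('C(n, 2) * (n - 2))%:Z -> t%:Z <= f n z.
  move=> z0 le; rewrite /f lez_divRL //; apply: le_trans le _.
  by rewrite PoszM -subzn ?lexx; lia.
have toR (z : int) : (4 * n%:Z * z - 10 * z + 1) %:~R = (4 * n%:R - 10) * z%:~R + 1 :> R.
  by rewrite !(intrD, intrM, intrB); ring.
pose y := (x%:Z); have yR : y%:~R = x%:R :> R by [].
have [ylo|loy] := lerP y%:~R (x0 R n).
- rewrite /U le_max; apply/orP; left.
  rewrite -floor_ge_int in ylo; set l := Num.floor _ in ylo *.
  have l0 : 0 < l by apply: lt_le_trans ylo; rewrite /y; lia.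
  have lx : l%:~R <= x0 R n by exact: floor_le.
  have tl : t%:Z <= g n l.
    apply: (@le_trans _ _ (g n y)); first by rewrite /g /y; nia.
    by rewrite /g; nia.
  rewrite le_min tl andbT; apply: fP => //.
  apply: le_trans (ler_wpM2r (ltW l0) tl) _.
  rewrite -(ler_int R) intrM toR -pmulrn -x0E.
  have lR : (0 : R) <= l%:~R by rewrite (ler_int R 0) ltW.
  have lx2 : l%:~R ^+ 2 <= x0 R n ^+ 2 by rewrite lerXn2r // nnegrE.
  have B0 : 0 <= 4 * n%:R - 10 :> R by lra.
  have := ler_wpM2l B0 lx2; lra.
rewrite /U le_max; apply/orP; right.
set h := Num.ceil _.
have xh : x0 R n <= h%:~R by exact: ceil_ge.
have hy : h <= y by rewrite ceil_le_int ltW.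
have h0 : 0 < h.
  rewrite -(ltr_int R); apply: lt_le_trans xh; rewrite lt_neqAle x0_ge0 andbT.
  apply: contra_eq_neq x0E => <-; rewrite expr0n mulr0 addr0 eq_sym pnatr_eq0.
  by rewrite muln_eq0 negb_or -!lt0n bin_gt0; lia.
have th : t%:Z * h <= ('C(n, 2) * (n - 2))%:Z by nia.
rewrite le_min fP //=.
rewrite -(ler_pM2r h0) -(ler_int R) intrM.
apply: le_trans (_ : ('C(n, 2) * (n - 2))%:R <= _).
  by rewrite -intrM pmulrn ler_int.
rewrite intrM toR -x0E.
have xh2 : x0 R n ^+ 2 <= h%:~R ^+ 2 by rewrite lerXn2r // nnegrE (le_trans x0_ge0).
have B0 : 0 <= 4 * n%:R - 10 :> R by lra.
have := ler_wpM2l B0 xh2; lra.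
Qed.

End UpperBound.

(** * Edge-colorings of the Johnson graph as colorings of cherries *)

Definition cherry n (a x y : 'I_n) : {set {set 'I_n}} :=
  [set [set a; x]; [set a; y]].

(** The edge as a set of pairs of points: cherries and edges can then be
compared without proofs that the pairs have two elements. *)
Definition edge_pairs n (e : edge (johnson2 n)) : {set {set 'I_n}} :=
  [set val A | A in val e].

Lemma edge_pairs_inj n : injective (@edge_pairs n).
Proof. by move=> e e' /(imset_inj val_inj) /val_inj. Qed.

Lemma set2_eqP n (a x b y : 'I_n) : a != x -> [set a; x] = [set b; y] ->
  (a = b /\ x = y) \/ (a = y /\ x = b).
Proof.
move=> nax eqs.
have: a \in [set b; y] by rewrite -eqs set21.
have: x \in [set b; y] by rewrite -eqs set22.
rewrite !inE => /orP[]/eqP ex /orP[]/eqP ea; subst; rewrite ?eqxx // in nax *.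
- by right.
- by left.
Qed.

Lemma cherry_eqP n (a x y b u v : 'I_n) : uniq [:: a; x; y] ->
  cherry a x y = cherry b u v ->
  a = b /\ ((x = u /\ y = v) \/ (x = v /\ y = u)).
Proof.
rewrite /= !inE negb_or andbT => /andP[/andP[nax nay] nxy] eqc.
have: [set a; x] \in cherry b u v by rewrite -eqc set21.
have: [set a; y] \in cherry b u v by rewrite -eqc set22.
rewrite !inE => /orP[]/eqP/(set2_eqP nay) [][]ey1 ey2
  /orP[]/eqP/(set2_eqP nax) [][]ex1 ex2; subst;
  rewrite ?eqxx // in nxy nax nay *; split=> //; by [left|right].
Qed.

Lemma edge_of_cherry n (a x y : 'I_n) : uniq [:: a; x; y] ->
  exists e : edge (johnson2 n), edge_pairs e = cherry a x y.
Proof.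
rewrite /= !inE negb_or andbT => /andP[/andP[nax nay] nxy].
have cx : #|[set a; x]| == 2 by rewrite cards2 nax.
have cy : #|[set a; y]| == 2 by rewrite cards2 nay.
pose A : johnson2 n := Sub [set a; x] cx.
pose B : johnson2 n := Sub [set a; y] cy.
have AB : [set A; B] \in edge_set (johnson2 n).
  apply/imsetP; exists (A, B) => //; rewrite inE /= /johnson_adj /=.
  have -> : [set a; x] :&: [set a; y] = [set a].
    rewrite -setUIr; apply/setP=> z; rewrite !inE.
    case: (z =P a) => //= _; apply/andP => -[/eqP-> ]; exact/negP.
  by rewrite cards1.
by exists (Sub [set A; B] AB); rewrite /edge_pairs SubK imsetU1 imset_set1.
Qed.

Lemma edge_has_cherry n (e : edge (johnson2 n)) (A : johnson2 n) : A \in val e ->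
  exists a x y, [/\ uniq [:: a; x; y], val A = [set a; x] & edge_pairs e = cherry a x y].
Proof.
case: e => e eE /=; case/imsetP: (eE) => -[B D] /=; rewrite inE /= => BD eBD Ae.
wlog AB : B D BD eBD / A = B.
  have: A \in [set B; D] by rewrite -eBD.
  rewrite !inE => /orP[]/eqP AE; first by move/(_ B D); apply.
  by move/(_ D B); apply; rewrite // ?(johnson_adj_sym D B) // setUC.
subst B; have [a [x [y [axy Ax Dy]]]] := johnson_adjP BD.
by exists a, x, y; split=> //; rewrite /edge_pairs /= eBD imsetU1 imset_set1 Ax Dy.
Qed.

Definition covers n (C : Type) (kappa : 'I_n -> 'I_n -> 'I_n -> C) c a x :=
  exists2 y, uniq [:: a; x; y] & kappa a x y = c \/ kappa x a y = c.

Lemma coversC n (C : Type) (kappa : 'I_n -> 'I_n -> 'I_n -> C) c a x :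
  covers kappa c a x -> covers kappa c x a.
Proof.
case=> y axy k; exists y; last by case: k; [right|left].
by move: axy; rewrite /= !inE !negb_or [x == a]eq_sym => /andP[/andP[-> ->] ->].
Qed.

(** [kappa a x y] is the color of the cherry with center [a] and leaves [x],
[y].  Two cherries that share the pair {a,x} are centered both at [a], or one
at [a] and the other at [x]; these are the two properness hypotheses. *)
Lemma achromatic_index_ge n (C : finType) (S : {set C}) (kappa : 'I_n -> 'I_n -> 'I_n -> C) :
  (forall a x y, uniq [:: a; x; y] -> kappa a x y = kappa a y x) ->
  (forall a x y, uniq [:: a; x; y] -> kappa a x y \in S) ->
  (forall a x y z, uniq [:: a; x; y; z] -> kappa a x y <> kappa a x z) ->
  (forall a x y z, uniq [:: a; x; y] -> uniq [:: x; a; z] -> kappa a x y <> kappa x a z) ->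
  {in S &, forall c d, c != d -> exists a x, covers kappa c a x /\ covers kappa d a x} ->
  #|S| <= achromatic_index (johnson2 n).
Proof.
move=> kC kS kstar ktri kcompl.
have [->|[s0 s0S]] := set_0Vmem S; first by rewrite cards0.
apply: (achromatic_indexP (johnson2 n)).2.
pose pk (e : edge (johnson2 n)) :=
  [pick p : 'I_n * 'I_n * 'I_n | uniq [:: p.1.1; p.1.2; p.2] &
     edge_pairs e == cherry p.1.1 p.1.2 p.2].
pose kE e := if pk e is Some p then kappa p.1.1 p.1.2 p.2 else s0.
have kEE e a x y : uniq [:: a; x; y] -> edge_pairs e = cherry a x y -> kE e = kappa a x y.
  move=> axy eaxy; rewrite /kE /pk; case: pickP => [[[b u] v] /andP[/= buv /eqP]|].
    by rewrite eaxy => /(cherry_eqP axy)[-> [][-> ->]] //; apply: kC.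
  by move/(_ (a, x, y)); move: axy => /= ->; rewrite eaxy eqxx.
have kES e : kE e \in S.
  by rewrite /kE /pk; case: pickP => [[[b u] v] /andP[/= /kS]|].
pose c : {ffun edge (johnson2 n) -> 'I_#|S|} := [ffun e => enum_rank_in s0S (kE e)].
have cE e e' : (c e == c e') = (kE e == kE e').
  rewrite !ffunE; apply/eqP/eqP=> [|-> //].
  by move/(congr1 enum_val); rewrite !enum_rankK_in.
apply/existsP; exists c; apply/andP; split.
  apply/forallP=> e; apply/forallP=> e'; apply/implyP=> /andP[nee' /set0Pn[A]].
  rewrite inE cE => /andP[/edge_has_cherry[a [x [y [axy Aax te]]]]].
  case/edge_has_cherry=> [b [u [v [buv Abu te']]]].
  rewrite (kEE _ _ _ _ axy te) (kEE _ _ _ _ buv te'); apply/eqP.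
  have nax : a != x by move: axy; rewrite /= !inE negb_or => /andP[/andP[]].
  move: Abu; rewrite Aax => /(set2_eqP nax) [][? ?]; subst b u; last exact: (ktri _ _ _ _ axy buv).
  apply: kstar; move: axy buv; rewrite /= !inE !negb_or !andbT.
  move=> /andP[/andP[-> ->] ->] /andP[/andP[_ ->] ->] /=.
  by apply: contraNneq nee' => yv; apply/eqP/edge_pairs_inj; rewrite te te' yv.
apply/forallP=> i; apply/forallP=> j; apply/implyP=> nij.
have nij' : enum_val i != enum_val j by rewrite (inj_eq enum_val_inj).
have [a [x [ca da]]] := kcompl _ _ (enum_valP i) (enum_valP j) nij'.
have cov i' : covers kappa (enum_val i') a x ->
    exists e : edge (johnson2 n), [set a; x] \in edge_pairs e /\ c e = i'.
  have centered b u y : uniq [:: b; u; y] -> kappa b u y = enum_val i' ->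
      [set a; x] = [set b; u] ->
      exists e : edge (johnson2 n), [set a; x] \in edge_pairs e /\ c e = i'.
    move=> buy kb ->; have [e te] := edge_of_cherry buy; exists e.
    by rewrite te set21 ffunE (kEE _ _ _ _ buy te) kb enum_valK_in.
  case=> y axy [ky|ky]; first by apply: centered ky _.
  apply: centered ky _; last by rewrite setUC.
  by move: axy; rewrite /= !inE !negb_or eq_sym !andbT => /andP[/andP[-> ->] ->].
have [[e [Ae ci]] [e' [Ae' cj]]] := (cov _ ca, cov _ da).
apply/existsP; exists e; apply/existsP; exists e'; rewrite ci cj !eqxx !andbT.
apply/andP; split; first by apply: contraNneq nij => ee'; rewrite -ci -cj ee'.
case/imsetP: Ae => A Ae AE; case/imsetP: Ae' => B Be BE.
have AB : A = B by apply: val_inj; rewrite -AE -BE.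
by apply/set0Pn; exists A; rewrite inE Ae AB.
Qed.

(** * Arithmetic of ordinals as integers modulo n *)

Lemma val_ordD m (x y : 'I_m.+1) :
  (x + y)%R = (if x + y < m.+1 then x + y else x + y - m.+1) :> nat.
Proof.
rewrite /=; have [xm ym] := (ltn_ord x, ltn_ord y).
case: ltnP => le; first by rewrite modn_small.
by rewrite -{1}(subnK le) modnDr modn_small //; lia.
Qed.

Lemma val_ordN m (x : 'I_m.+1) : x != 0%R -> (- x)%R = m.+1 - x :> nat.
Proof.
rewrite -val_eqE /= => x0; have xm := ltn_ord x.
by rewrite modn_small //; lia.
Qed.

Lemma ord_neq0 m (r : 'I_m.+1) : (r != 0%R) = (0 < r).
Proof. by rewrite lt0n -val_eqE. Qed.

Lemma ord_double_inj m : odd m.+1 -> injective (fun x : 'I_m.+1 => x + x)%R.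
Proof.
move=> oN x y /(congr1 (@nat_of_ord _)); rewrite !val_ordD => e; apply: val_inj => /=.
by have [xm ym] := (ltn_ord x, ltn_ord y); move: e; case: ltnP => ?; case: ltnP => ? ?; lia.
Qed.

(** * The coloring for odd n *)

(** The classical 1-factorization of a complete graph of even order: the
vertices are those of an abelian group of odd order and a point at infinity
[None], and an edge is colored by the sum of its ends, the point at infinity
standing for the other end. *)
Definition pair_sum (Z : zmodType) (u v : option Z) : Z :=
  match u, v with
  | Some x, Some y => x + y
  | Some x, None | None, Some x => x + x
  | None, None => 0
  end%R.

Lemma pair_sumC (Z : zmodType) (u v : option Z) : pair_sum u v = pair_sum v u.
Proof. by case: u v => [x|] [y|] //=; rewrite addrC. Qed.

Lemma pair_sum_inj (Z : zmodType) (u v w : option Z) :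
  injective (fun x : Z => x + x)%R -> u != v -> u != w ->
  pair_sum u v = pair_sum u w -> v = w.
Proof.
move=> inj2; case: u v w => [u|] [v|] [w|] //=.
- by move=> _ _ /addrI->.
- by move=> uv _ /addrI vu; rewrite vu eqxx in uv.
- by move=> _ uw /addrI wu; rewrite wu eqxx in uw.
- by move=> _ _ /inj2->.
Qed.

Lemma pair_sum_surj (Z : finZmodType) (u : option Z) (s : Z) :
  injective (fun x : Z => x + x)%R -> exists2 v, u != v & pair_sum u v = s.
Proof.
move=> inj2; case: u => [u|].
  case: (eqVneq u (s - u)%R) => us.
    by exists None => //=; rewrite {2}us addrC subrK.
  by exists (Some (s - u)%R); rewrite //= addrC subrK.
by have [h _ hK] := injF_bij inj2; exists (Some (h s)) => //=; apply: hK.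
Qed.

Lemma achromatic_odd_ge n : 2 < n -> odd n -> n * (n - 2) <= achromatic_index (johnson2 n).
Proof.
case: n => [|[|[|m]]] // _ om.
have inj2 : injective (fun x : 'I_m.+1 => x + x)%R.
  by apply: ord_double_inj; move: om; rewrite /= !negbK.
(* The two [unlift]s identify the vertices other than [a] with the group and
   the point at infinity. *)
pose pos (a x : 'I_m.+3) : option 'I_m.+1 := obind (unlift ord_max) (unlift a x).
have posI a x y : a != x -> a != y -> pos a x = pos a y -> x = y.
  move=> /unlift_some[x' -> ex] /unlift_some[y' -> ey]; rewrite /pos ex ey /=.
  case: (unliftP ord_max x') => [u|] ->; case: (unliftP ord_max y') => [v|] -> //.
  by case=> ->.
have posS a u : exists2 x, a != x & pos a x = u.
  case: u => [u|].
    exists (lift a (lift ord_max u)); first exact: neq_lift.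
    by rewrite /pos liftK /= liftK.
  exists (lift a ord_max); first exact: neq_lift.
  by rewrite /pos liftK /= unlift_none.
pose col a x y := (a, pair_sum (pos a x) (pos a y)).
have cov a s x : a != x -> covers col (a, s) a x.
  move=> ax; have [u xu us] := pair_sum_surj (pos a x) s inj2.
  have [y ay yu] := posS a u; exists y; last by left; rewrite /col yu us.
  rewrite /= !inE negb_or ax ay /= andbT.
  by apply: contraNneq xu => ->; rewrite yu.
have -> : m.+3 * (m.+3 - 2) = #|[set: 'I_m.+3 * 'I_m.+1]|.
  by rewrite cardsT card_prod !card_ord; congr (_ * _); lia.
apply: (@achromatic_index_ge m.+3 _ _ col).
- by move=> a x y _; rewrite /col pair_sumC.
- by move=> a x y _; rewrite inE.
- move=> a x y z; rewrite /= !inE !negb_or => /and4P[/and3P[ax ay az] /andP[xy xz] yz _].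
  have neq u v : a != u -> a != v -> u != v -> pos a u != pos a v.
    by move=> au av; apply: contraNneq => /posI ->.
  case=> /(pair_sum_inj inj2 (neq _ _ ax ay xy) (neq _ _ ax az xz)).
  by move/(posI _ _ _ ay az)=> e; rewrite e eqxx in yz.
- move=> a x y z; rewrite /= !inE !negb_or => /andP[/andP[ax _] _] _ [e _].
  by rewrite e eqxx in ax.
case=> a s [b t] _ _ _; case: (eqVneq a b) => [<-|ab].
  by exists a, (lift a ord0); split; apply: cov; apply: neq_lift.
exists a, b; split; first exact: cov.
have [|y bay []] := @cov b t a; rewrite 1?eq_sym //.
  move=> e; exists y; [|by right].
  by move: bay; rewrite /= !inE !negb_or [b == a]eq_sym => /andP[/andP[-> ->] ->].
move=> e; exists y; [|by left].
by move: bay; rewrite /= !inE !negb_or [b == a]eq_sym => /andP[/andP[-> ->] ->].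
Qed.

(** * Near-perfect matchings around a center, for even n *)

(** Here n = p + 2, and [r] is the position of a vertex relative to the center.
The n - 1 = p + 1 positions other than 0 are labeled by the integers modulo
p + 1; the pairs whose labels have a given sum form a near-perfect matching
that misses the position whose label is half of that sum.  The sums 0 and 1
together form the path through the labels 0, 1, -1, 2, -2, and so on up to the
half p/2 + 1 of 1.  Four labels are prescribed: the ends 0 and p/2 + 1 of the
path at the positions -2 and 2, and the consecutive labels 1 and -1 at the
positions -1 and 1.  The positions -2 and -1 follow the rule that [r] is labeled
r + 1; the labels 2 and 3 that the positions 1 and 2 would have are exchanged
with those that they take instead. *)
Definition label_nat p (r : nat) : nat :=
  if r == 1 then p
  else if r == 2 then p./2.+1
  else if r == p.-1 then 2
  else if r == p./2 then 3
  else if p <= r then r - p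
  else r.+1.

(** On that path cut between 1 and -1, the neighbor of [u] on the side of the
end of its piece; [u] itself if [u] is an end. *)
Definition partner p (u : nat) : nat :=
  if u <= 1 then 0 else if u <= p./2 then p.+1 - u else p.+2 - u.

Section EvenOrder.
Variable p : nat.
Hypotheses (p_gt3 : 3 < p) (p_even : ~~ odd p).

Definition label (r : 'I_p.+2) : 'I_p.+1 := inord (label_nat p r).

Lemma val_label r : r != 0%R -> label r = label_nat p r :> nat.
Proof.
rewrite ord_neq0 => r0; have rm := ltn_ord r; rewrite /= inordK // /label_nat.
by do 5 (case: ifP => ?; first lia); lia.
Qed.

Lemma label_inj r s : r != 0%R -> s != 0%R -> label r = label s -> r = s.
Proof.
move=> r0 s0 /(congr1 (@nat_of_ord _)); rewrite !val_label // => e; apply: val_inj => /=.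
move: r0 s0 e; rewrite !ord_neq0 /= /label_nat; have [rm sm] := (ltn_ord r, ltn_ord s).
by move=> r0 s0; do ?[case: ifP => ?]; lia.
Qed.

Lemma label_surj u : exists2 r, r != 0%R & label r = u.
Proof.
have um := ltn_ord u.
have [r [r0 rm ru]] : exists r, [/\ r != 0, r < p.+2 & label_nat p r = u].
  have pre r : r != 0 -> r < p.+2 -> label_nat p r = u ->
    exists r, [/\ r != 0, r < p.+2 & label_nat p r = u] by exists r.
  case: (eqVneq (nat_of_ord u) p) => e1; last case: (eqVneq (nat_of_ord u) p./2.+1) => e2;
    last case: (eqVneq (nat_of_ord u) 2) => e3; last case: (eqVneq (nat_of_ord u) 3) => e4;
    last case: (leqP u 1) => e5.
  - by apply: (pre 1) => //; rewrite e1.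
  - by apply: (pre 2); rewrite ?e2 //; lia.
  - by apply: (pre p.-1); rewrite /label_nat; do ?[case: ifP => ?]; lia.
  - by apply: (pre p./2); rewrite /label_nat; do ?[case: ifP => ?]; lia.
  - by apply: (pre (u + p)); rewrite /label_nat; do ?[case: ifP => ?]; lia.
  - by apply: (pre u.-1); rewrite /label_nat; do ?[case: ifP => ?]; lia.
have r0' : Ordinal rm != 0%R by rewrite -val_eqE.
by exists (Ordinal rm) => //; apply: val_inj; rewrite /= val_label.
Qed.

Definition label_sum r s : 'I_p.+1 := (label r + label s)%R.

Lemma label_double_inj r s : r != 0%R -> s != 0%R ->
  label_sum r r = label_sum s s -> r = s.
Proof.
by move=> r0 s0 /(ord_double_inj p_even); apply: label_inj.
Qed.

(** The sums 0 and 1, whose matchings make up the path. *)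
Definition dissolved (c : 'I_p.+1) := c <= 1.

Lemma dissolved_double r : r != 0%R ->
  dissolved (label_sum r r) = (r == 2 :> nat) || (r == p :> nat).
Proof.
move=> r0; rewrite /dissolved /label_sum val_ordD.
have := val_label r0; move: (nat_of_ord (label r)) => l; rewrite /label_nat.
move: r0; rewrite ord_neq0 => r0; have rm := ltn_ord r.
by do ?[case: ifP => ?]; lia.
Qed.

(** The positions missed by the dissolved matchings are 2 and -2.  This symmetry
makes the color that a pair of the path is to complete one that was kept. *)
Lemma dissolved_doubleN r : r != 0%R ->
  dissolved (label_sum (- r)%R (- r)%R) = dissolved (label_sum r r).
Proof.
move=> r0; rewrite !dissolved_double ?oppr_eq0 // val_ordN //.
by move: r0; rewrite ord_neq0 /=; have rm := ltn_ord r; lia.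
Qed.

(** The pair of positions 1 and -1, at which the path is cut. *)
Definition cut_pair (r s : 'I_p.+2) : bool :=
  (r + s == 0)%R && ((r == 1 :> nat) || (s == 1 :> nat)).

(** The pair {r,s} of the path is the one assigned to [r]. *)
Definition serves (r s : 'I_p.+2) : bool := nat_of_ord (label s) == partner p (label r).

Lemma cut_pair_val r s : r != 0%R -> s != 0%R ->
  cut_pair r s = (r == 1 :> nat) && (s == p.+1 :> nat) ||
    (r == p.+1 :> nat) && (s == 1 :> nat).
Proof.
rewrite /cut_pair !ord_neq0 -[(_ + _ == _)%R]negbK ord_neq0 val_ordD /= => r0 s0.
have [rm sm] := (ltn_ord r, ltn_ord s).
by case: ifP => ?; lia.
Qed.

Lemma cut_pair_label r s : r != 0%R -> s != 0%R ->
  cut_pair r s = (label r == p :> nat) && (label s == 1 :> nat) ||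
    (label r == 1 :> nat) && (label s == p :> nat).
Proof.
move=> r0 s0; rewrite cut_pair_val // !val_label // /label_nat.
move: r0 s0; rewrite !ord_neq0 => r0 s0.
have [rm sm] := (ltn_ord r, ltn_ord s).
by do ?[case: ifP => ?]; lia.
Qed.

Lemma serves_one r s : r != 0%R -> s != 0%R -> r != s -> dissolved (label_sum r s) ->
  ~~ cut_pair r s -> serves r s (+) serves s r.
Proof.
move=> r0 s0 nrs; rewrite cut_pair_label // /dissolved /label_sum val_ordD /serves.
have: label r != label s :> nat.
  by apply: contraNneq nrs => /val_inj /label_inj ->.
have [] := (ltn_ord (label r), ltn_ord (label s)).
rewrite /= /partner; move: (nat_of_ord (label r)) (nat_of_ord (label s)) => u v um vm uv.
by do ?[case: ifP => ?]; lia.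
Qed.

(** The ends of the path, which the dissolved matchings miss, get no pair. *)
Lemma serves_dissolved r s : r != 0%R -> s != 0%R -> r != s -> serves r s ->
  ~~ dissolved (label_sum r r).
Proof.
move=> r0 s0 nrs; rewrite /dissolved /label_sum val_ordD /serves.
have: label r != label s :> nat.
  by apply: contraNneq nrs => /val_inj /label_inj ->.
have [] := (ltn_ord (label r), ltn_ord (label s)).
rewrite /= /partner; move: (nat_of_ord (label r)) (nat_of_ord (label s)) => u v um vm uv.
by do ?[case: ifP => ?]; lia.
Qed.

Lemma served_exists r : r != 0%R -> ~~ dissolved (label_sum r r) ->
  exists s, [/\ s != 0%R, s != r, dissolved (label_sum r s), ~~ cut_pair r s & serves r s].
Proof.
move=> r0 ndr.
have wm : partner p (label r) < p.+1.
  by rewrite /partner; have := ltn_ord (label r); do ?[case: ifP => ?]; lia.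
have [s s0 sw] := label_surj (Ordinal wm).
have vs : label s = partner p (label r) :> nat by rewrite sw.
exists s; rewrite s0 cut_pair_label // /serves /dissolved /label_sum vs eqxx.
move: ndr; rewrite /dissolved /label_sum !val_ordD vs.
have rs : label s != label r :> nat -> s != r by apply: contraNneq => ->.
rewrite vs in rs; move: rs; have := ltn_ord (label r); rewrite /=.
move: (nat_of_ord (label r)) => u um.
have [w wE] : exists w, w = partner p u by exists (partner p u).
rewrite -wE; move: wE; rewrite /partner => wE rs ndr; split=> //; first apply: rs.
all: by move: ndr wE; do ?[case: ifP => ?]; lia.
Qed.

End EvenOrder.

(** * The coloring for even n *)

(** [e] distributes the [n] leftover cherries, those with center [b] and leaves
[b - 1] and [b + 1], among the [k] further colors.  Consecutive centers get
different colors, as their cherries share a pair, and every color occurs at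
[a] or next to it, so that it reaches every vertex. *)
Section EvenColoring.
Variables (p k : nat) (e : 'I_p.+2 -> 'I_k).
Hypotheses (p_gt3 : 3 < p) (p_even : ~~ odd p).
Hypothesis e_succ : forall b, e b <> e (b + 1)%R.
Hypothesis e_near : forall a i, [\/ e a = i, e (a + 1)%R = i | e (a - 1)%R = i].

(** The color [inl (b, s)] belongs to the matching of sum [s] at the center [b].
A cherry with center [b] whose pair of leaves is assigned to [x] completes the
color at the center [x] whose matching misses [b], that is, the one whose sum is
twice the label of [b - x]. *)
Definition even_color (b x y : 'I_p.+2) : 'I_p.+2 * 'I_p.+1 + 'I_k :=
  let r := (x - b)%R in let s := (y - b)%R in
  if ~~ dissolved (label_sum r s) then inl (b, label_sum r s)
  else if cut_pair r s then inr (e b)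
  else if serves r s then inl (x, label_sum (- r)%R (- r)%R)
  else inl (y, label_sum (- s)%R (- s)%R).

Definition even_colors : {set 'I_p.+2 * 'I_p.+1 + 'I_k} :=
  [set c | if c is inl (_, s) then ~~ dissolved s else true].

Lemma card_even_colors : #|even_colors| = p.+2 * p.-1 + k.
Proof.
pose D := [set s : 'I_p.+1 | ~~ dissolved s].
have -> : even_colors = inl @: setX [set: 'I_p.+2] D :|: inr @: [set: 'I_k].
  apply/setP=> -[[b s]|i]; rewrite !inE; last by rewrite imset_f ?orbT ?inE.
  rewrite mem_imset ?inE /=; last by move=> ? ? [].
  by case: imsetP => [[]|_] //; rewrite orbF.
have disj : [disjoint (inl @: setX [set: 'I_p.+2] D) &
    (inr @: [set: 'I_k] : {set 'I_p.+2 * 'I_p.+1 + 'I_k})].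
  by apply/pred0P=> c /=; apply/andP=> -[/imsetP[? _ ->] /imsetP[]].
rewrite cardsU (disjoint_setI0 disj) cards0 subn0 !card_imset; try by move=> ? ? [].
rewrite cardsX !cardsT !card_ord; congr (_ * _ + _).
have -> : D = ~: [set 0%R; inord 1].
  apply/setP=> s; rewrite !inE -!val_eqE /= inordK; last by lia.
  by rewrite /dissolved; case: (nat_of_ord s) => [|[|]].
have n01 : 0%R != inord 1 :> 'I_p.+1 by rewrite -val_eqE /= inordK; lia.
by rewrite cardsCs setCK cards2 n01 card_ord; lia.
Qed.

Lemma subr_neq0 (b x : 'I_p.+2) : b != x -> (x - b != 0)%R.
Proof. by rewrite subr_eq0 eq_sym. Qed.

Lemma inl_pair_inj (A B D : Type) (a a' : A) (b b' : B) :
  inl (a, b) = inl (a', b') :> A * B + D -> a = a' /\ b = b'.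
Proof. by case. Qed.

Lemma cut_pairP (r s : 'I_p.+2) : r != 0%R -> s != 0%R -> cut_pair r s ->
  s = (- r)%R /\ (r = 1%R \/ r = (-1)%R).
Proof.
move=> r0 s0 /andP[/eqP rs rs1].
have sE : s = (- r)%R by apply/eqP; rewrite -addr_eq0 addrC rs.
split=> //; case/orP: rs1 => /eqP r1; [left|right].
  by apply: val_inj; rewrite /= r1 modn_small.
by rewrite -[r]opprK -sE; congr (- _)%R; apply: val_inj; rewrite /= r1 modn_small.
Qed.

Lemma even_colorC b x y : uniq [:: b; x; y] -> even_color b x y = even_color b y x.
Proof.
rewrite /= !inE negb_or andbT => /andP[/andP[bx b_y] xy].
rewrite /even_color /label_sum [in RHS]addrC; case: ifP => // /negbFE dis.
set r := (x - b)%R; set s := (y - b)%R.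
have -> : cut_pair s r = cut_pair r s by rewrite /cut_pair addrC orbC.
case: ifP => // nap.
have rs : r != s by apply: contraNneq xy => /addIr ->.
have := serves_one p_gt3 p_even (subr_neq0 bx) (subr_neq0 b_y) rs dis (negbT nap).
by rewrite -/r -/s; case: (serves r s); case: (serves s r).
Qed.

Variant even_color_spec (b x y : 'I_p.+2) : 'I_p.+2 * 'I_p.+1 + 'I_k -> Prop :=
  | MainColor : ~~ dissolved (label_sum (x - b) (y - b))%R ->
      even_color_spec b x y (inl (b, label_sum (x - b) (y - b))%R)
  | ExtraColor : cut_pair (x - b)%R (y - b)%R -> even_color_spec b x y (inr (e b))
  | LeftColor : serves (x - b)%R (y - b)%R ->
      even_color_spec b x y (inl (x, label_sum (b - x) (b - x))%R)
  | RightColor : serves (y - b)%R (x - b)%R ->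
      even_color_spec b x y (inl (y, label_sum (b - y) (b - y))%R).

Lemma even_colorP b x y : uniq [:: b; x; y] -> even_color_spec b x y (even_color b x y).
Proof.
rewrite /= !inE negb_or andbT => /andP[/andP[bx b_y] xy].
rewrite /even_color !opprB; case: ifP => [|/negbFE dis]; first by constructor.
case: ifP => [|nap]; first by constructor.
case: ifP => [|ns]; first by constructor.
constructor.
have rs : (x - b != y - b)%R by apply: contraNneq xy => /addIr ->.
have := serves_one p_gt3 p_even (subr_neq0 bx) (subr_neq0 b_y) rs dis (negbT nap).
by rewrite ns.
Qed.

Lemma even_color_in b x y : uniq [:: b; x; y] -> even_color b x y \in even_colors.
Proof.
move=> bxy; move: (bxy); rewrite /= !inE negb_or andbT => /andP[/andP[bx b_y] xy].
have rs : (x - b != y - b)%R by apply: contraNneq xy => /addIr ->.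
case: (even_colorP bxy) => // sv; rewrite -opprB dissolved_doubleN ?subr_neq0 //.
  exact: serves_dissolved (subr_neq0 bx) (subr_neq0 b_y) rs sv.
by apply: serves_dissolved (subr_neq0 b_y) (subr_neq0 bx) _ sv; rewrite // eq_sym.
Qed.

Lemma even_color_star b x y z : uniq [:: b; x; y; z] -> even_color b x y <> even_color b x z.
Proof.
rewrite /= !inE !negb_or => /and4P[/and3P[bx b_y bz] /andP[xy xz] yz _].
have bxy : uniq [:: b; x; y] by rewrite /= !inE negb_or bx b_y xy.
have bxz : uniq [:: b; x; z] by rewrite /= !inE negb_or bx bz xz.
have [r0 s0 t0] := And3 (subr_neq0 bx) (subr_neq0 b_y) (subr_neq0 bz).
have LI : (label (y - b) = label (z - b))%R -> False.
  by move/(label_inj p_gt3 p_even s0 t0)/addIr => yzE; rewrite yzE eqxx in yz.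
case: (even_colorP bxy) => [_|ap|sv|_]; case: (even_colorP bxz) => [_|ap'|sv'|_] //;
  try by case=> E; rewrite E eqxx in bx b_y bz xy xz yz.
- by move=> cc; have [_ /addrI] := inl_pair_inj cc.
- move=> _; have [E _] := cut_pairP r0 s0 ap; have [E' _] := cut_pairP r0 t0 ap'.
  by apply: LI; rewrite E E'.
- by move=> _; apply: LI; apply: val_inj; rewrite /= (eqP sv) (eqP sv').
Qed.

(** A matching color at [b] on the cherry with leaves [x], [y] cannot be completed
by a cherry centered at [x] on the pair {b,x}: this would mean that the matching
misses [x], one of the leaves. *)
Lemma even_color_triangle b x y z : uniq [:: b; x; y] -> uniq [:: x; b; z] ->
  even_color b x y <> even_color x b z.
Proof.
move=> bxy xbz.
move: (bxy); rewrite /= !inE negb_or andbT => /andP[/andP[bx b_y] xy].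
move: (xbz); rewrite /= !inE negb_or andbT => /andP[/andP[xb xz] bz].
have r0 := subr_neq0 bx; have s0 := subr_neq0 b_y; have t0 := subr_neq0 xz.
case: (even_colorP bxy) => [_|ap|sv|sv]; case: (even_colorP xbz) => [_|ap'|sv'|sv'] //;
  try by case=> E; rewrite E eqxx in bx b_y bz xy xz.
- move=> cc; have [_ /addrI/(label_inj p_gt3 p_even s0 r0)/addIr E] := inl_pair_inj cc.
  by rewrite E eqxx in xy.
- case; have [_ [E|E]] := cut_pairP r0 s0 ap.
    by rewrite -[x](subrK b) E addrC; apply: e_succ.
  by rewrite -{1}[b](subrK x) -opprB E opprK addrC => /esym; apply: e_succ.
- move=> cc; have [_ /addrI/esym/(label_inj p_gt3 p_even t0 (subr_neq0 xb))/addIr E] := inl_pair_inj cc.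
  by rewrite E eqxx in bz.
- move=> cc; have [yz] := inl_pair_inj cc; rewrite -yz => /(label_double_inj p_gt3 p_even _ _) E.
  have yb : (b - y != 0)%R by apply: subr_neq0; rewrite eq_sym.
  have yx : (x - y != 0)%R by apply: subr_neq0; rewrite eq_sym.
  by have := E yb yx => /addIr bxE; rewrite bxE eqxx in bx.
Qed.

(** If the matching of sum [s] at [a] misses [x], then the cherry that covers
{a,x} is centered at [x]: its leaves are the pair assigned to [a] there. *)
Lemma covers_star a s x : ~~ dissolved s -> a != x -> covers even_color (inl (a, s)) a x.
Proof.
move=> nds ax; have r0 := subr_neq0 ax.
have [s' s0 sE] := label_surj p_gt3 p_even (s - label (x - a))%R.
have sumE : label_sum (x - a)%R s' = s by rewrite /label_sum sE addrC subrK.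
have [rs|nrs] := eqVneq s' (x - a)%R; last first.
  exists (a + s')%R; last by left; rewrite /even_color [(a + s')%R]addrC addrK sumE nds.
  rewrite /= !inE negb_or ax /= andbT; apply/andP; split.
    by rewrite -subr_eq0 opprD addNKr oppr_eq0.
  by apply: contraNneq nrs => ->; rewrite addrC addrA addNr add0r.
rewrite rs in sumE.
have q0 : (a - x != 0)%R by apply: subr_neq0; rewrite eq_sym.
have [|t [t0 tr tdis tap tsv]] := served_exists p_gt3 p_even q0.
  by rewrite -opprB dissolved_doubleN // sumE.
exists (x + t)%R; last first.
  right; rewrite /even_color [(x + t)%R]addrC addrK tdis /= (negbTE tap) tsv opprB.
  by rewrite sumE.
rewrite /= !inE negb_or ax /= andbT; apply/andP; split.
  by apply: contraNneq tr => ->; rewrite addrC addrA addNr add0r.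
by rewrite -subr_eq0 opprD addNKr oppr_eq0.
Qed.

Lemma val_ordN1 : nat_of_ord (- 1 : 'I_p.+2)%R = p.+1.
Proof. by rewrite val_ordN ?oner_eq0 //=; lia. Qed.

Lemma extra_uniq (b : 'I_p.+2) : uniq [:: b; b + 1; b - 1]%R.
Proof.
rewrite /= !inE negb_or andbT.
rewrite -{1}[b]addr0 (inj_eq (addrI b)) -{1}[b]addr0 !(inj_eq (addrI b)).
rewrite ![0%R == _]eq_sym oppr_eq0 oner_eq0 /=.
by apply/eqP => /(congr1 (@nat_of_ord _)); rewrite val_ordN1 /= modn_small; lia.
Qed.

Lemma even_color_extra b : even_color b (b + 1)%R (b - 1)%R = inr (e b).
Proof.
rewrite /even_color ![(b + _)%R]addrC !addrK.
have -> : dissolved (label_sum (1 : 'I_p.+2)%R (- 1)%R) = true.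
  rewrite /dissolved /label_sum val_ordD !val_label ?oppr_eq0 ?oner_eq0 //.
  have -> : nat_of_ord (1 : 'I_p.+2)%R = 1 by rewrite /= modn_small.
  have -> : label_nat p 1 = p by [].
  have -> : label_nat p (- 1 : 'I_p.+2)%R = 1.
    by rewrite val_ordN1 /label_nat; do ?[case: ifP => ?]; lia.
  by case: ifP => ?; lia.
by rewrite /cut_pair addrN eqxx.
Qed.

Lemma covers_extra b i x : e b = i -> x = (b + 1)%R \/ x = (b - 1)%R ->
  covers even_color (inr i) b x.
Proof.
have bu := extra_uniq b; move=> <- [->|->]; [exists (b - 1)%R|exists (b + 1)%R] => //.
- by left; apply: even_color_extra.
- by move: bu; rewrite /= !inE !negb_or [(b - 1)%R == _]eq_sym => /andP[/andP[-> ->] ->].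
- by left; rewrite -even_colorC //; apply: even_color_extra.
Qed.

Lemma even_color_complete : {in even_colors &, forall c d, c != d ->
  exists a x, covers even_color c a x /\ covers even_color d a x}.
Proof.
have n1 (b : 'I_p.+2) : b != (b + 1)%R by rewrite -subr_eq0 opprD addNKr oppr_eq0 oner_eq0.
have n1' (b : 'I_p.+2) : b != (b - 1)%R by rewrite -subr_eq0 opprB addrC subrK oner_eq0.
have mixed a s i : ~~ dissolved s ->
    exists x y, covers even_color (inl (a, s)) x y /\ covers even_color (inr i) x y.
  move=> nds; case: (e_near a i) => E.
  - exists a, (a + 1)%R; split; first exact: covers_star.
    by apply: covers_extra; rewrite //; left.
  - exists a, (a + 1)%R; split; first exact: covers_star.
    by apply/coversC/covers_extra; rewrite // addrK; right.
  - exists a, (a - 1)%R; split; first exact: covers_star.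
    by apply/coversC/covers_extra; rewrite // subrK; left.
case=> [[a s]|i] [[b t]|j]; rewrite !inE => cS dS ncd.
- have [ab|ab] := eqVneq a b.
    by subst b; exists a, (a + 1)%R; split; apply: covers_star.
  by exists a, b; split; [|apply: coversC]; apply: covers_star; rewrite // eq_sym.
- exact: mixed.
- by have [x [y [cx cy]]] := mixed b t i dS; exists x, y.
have [b eb] : exists b, e b = i by case: (e_near 0%R i); eauto.
have [E|E|E] := e_near b j.
- by rewrite -eb -E eqxx in ncd.
- exists b, (b + 1)%R; split; first by apply: covers_extra; rewrite //; left.
  by apply/coversC/covers_extra; rewrite // addrK; right.
- exists b, (b - 1)%R; split; first by apply: covers_extra; rewrite //; right.
  by apply/coversC/covers_extra; rewrite // subrK; left.
Qed.

Lemma achromatic_even_ge : p.+2 * p.-1 + k <= achromatic_index (johnson2 p.+2).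
Proof.
rewrite -card_even_colors; apply: (@achromatic_index_ge _ _ _ even_color).
- exact: even_colorC.
- exact: even_color_in.
- exact: even_color_star.
- exact: even_color_triangle.
- exact: even_color_complete.
Qed.

End EvenColoring.

Lemma ord_succ_val m (b : 'I_m.+2) :
  (b + 1)%R = (if b == m.+1 :> nat then 0 else b.+1) :> nat.
Proof. by have := ltn_ord b; rewrite val_ordD /= modn_small //; do ?[case: ifP => ?]; lia. Qed.

Lemma ord_pred_val m (b : 'I_m.+2) :
  (b - 1)%R = (if b == 0 :> nat then m.+1 else b.-1) :> nat.
Proof.
have := ltn_ord b; rewrite val_ordD val_ordN ?oner_eq0 //= modn_small //.
by do ?[case: ifP => ?]; lia.
Qed.

Lemma achromatic_even_ge2 n : 5 < n -> ~~ odd n ->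
  n * (n - 3) + 2 <= achromatic_index (johnson2 n).
Proof.
case: n => [|[|p]] // n6 on.
have p3 : 3 < p by lia.
have po : ~~ odd p by lia.
have -> : p.+2 - 3 = p.-1 by lia.
apply: (@achromatic_even_ge p 2 (fun b => inord (b %% 2))) => // [b|a i].
  move/(congr1 (@nat_of_ord _)); rewrite !inordK ?ltn_pmod // ord_succ_val.
  by have := ltn_ord b; case: ifP => ? ?; lia.
have eqI (c : 'I_p.+2) : c %% 2 = i -> inord (c %% 2) = i.
  by move=> ci; apply: val_inj; rewrite /= inordK ?ltn_pmod.
have [ia aa] := (ltn_ord i, ltn_ord a).
have [E|E] : a %% 2 = i \/ (if a == p.+1 :> nat then 0 else a.+1) %% 2 = i.
- by case: ifP => ?; lia.
- by apply/Or31/eqI.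
- by apply/Or32/eqI; rewrite ord_succ_val.
Qed.

(** The residues modulo 3 of [a - 1], [a] and [a + 1] are distinct, so that three
colors still reach every vertex; this needs 3 to divide [n], since the vertices
are taken modulo [n]. *)
Lemma achromatic_even_ge3 n : 5 < n -> 6 %| n ->
  n * (n - 3) + 3 <= achromatic_index (johnson2 n).
Proof.
case: n => [|[|p]] // n6 on.
have p3 : 3 < p by lia.
have po : ~~ odd p by lia.
have -> : p.+2 - 3 = p.-1 by lia.
apply: (@achromatic_even_ge p 3 (fun b => inord (b %% 3))) => // [b|a i].
  move/(congr1 (@nat_of_ord _)); rewrite !inordK ?ltn_pmod // ord_succ_val.
  by have := ltn_ord b; case: ifP => ? ?; lia.
have eqI (c : 'I_p.+2) : c %% 3 = i -> inord (c %% 3) = i.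
  by move=> ci; apply: val_inj; rewrite /= inordK ?ltn_pmod.
have [ia aa] := (ltn_ord i, ltn_ord a).
have [E|E|E] : [\/ a %% 3 = i, (if a == p.+1 :> nat then 0 else a.+1) %% 3 = i
   | (if a == 0 :> nat then p.+1 else a.-1) %% 3 = i].
- case: (eqVneq (a %% 3) i) => [|ai]; first by constructor.
  case: (eqVneq ((if a == p.+1 :> nat then 0 else a.+1) %% 3) i) => [|ai']; first by constructor.
  by constructor 3; move: ai ai'; do ?[case: ifP => ?]; lia.
- by apply/Or31/eqI.
- by apply/Or32/eqI; rewrite ord_succ_val.
- by apply/Or33/eqI; rewrite ord_pred_val.
Qed.

(** * The cases n = 3, 4, 5 *)

(** Row [a] lists the colors of the three cherries with center [a], each at the
index of the vertex outside the cherry; the entries 7 on the diagonal are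
padding. *)
Definition color4 (a x y : nat) : nat :=
  let missing := 6 - (a + x + y) in
  nth 0 (nth [::] [:: [:: 7; 2; 1; 0];
                      [:: 0; 7; 3; 2];
                      [:: 6; 5; 7; 4];
                      [:: 1; 3; 4; 7]] a) missing.

Lemma achromatic4_ge : 7 <= achromatic_index (johnson2 4).
Proof.
pose kappa (a x y : 'I_4) : 'I_7 := inZp (color4 a x y).
pose all4 (P : pred nat) := all P (iota 0 4).
have all_ord (P : pred nat) m :
    all P (iota 0 m) -> forall a : 'I_m, P a.
  by move=> /allP ok a; apply: ok; rewrite mem_iota /= ltn_ord.
have uval (s : seq 'I_4) : uniq s = uniq (map (@nat_of_ord 4) s).
  by rewrite map_inj_uniq //; apply: val_inj.
rewrite -[7](card_ord 7) -cardsT; apply: (@achromatic_index_ge 4 _ _ kappa).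
- by move=> a x y _; apply: val_inj; rewrite /= /color4 addnAC.
- by move=> *; rewrite inE.
- move=> a x y z; rewrite uval => un /(congr1 (@nat_of_ord _)) /= E.
  have : all4 (fun a => all4 (fun x => all4 (fun y => all4 (fun z =>
      uniq [:: a; x; y; z] ==> (color4 a x y %% 7 != color4 a x z %% 7))))) by [].
  by move=> /all_ord/(_ a)/all_ord/(_ x)/all_ord/(_ y)/all_ord/(_ z) /implyP/(_ un)/eqP.
- move=> a x y z; rewrite !uval => un un' /(congr1 (@nat_of_ord _)) /= E.
  have : all4 (fun a => all4 (fun x => all4 (fun y => all4 (fun z =>
      uniq [:: a; x; y] ==> uniq [:: x; a; z] ==>
      (color4 a x y %% 7 != color4 x a z %% 7))))) by [].
  move=> /all_ord/(_ a)/all_ord/(_ x)/all_ord/(_ y)/all_ord/(_ z).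
  by move=> /implyP/(_ un)/implyP/(_ un')/eqP.
pose cov c a x := has (fun y =>
  uniq [:: a; x; y] && ((color4 a x y == c) || (color4 x a y == c))) (iota 0 4).
have covP (c : 'I_7) (a x : nat) (a4 : a < 4) (x4 : x < 4) :
    cov c a x -> covers kappa c (Ordinal a4) (Ordinal x4).
  case/hasP=> y; rewrite mem_iota /= => y4 /andP[un k]; exists (Ordinal y4); first by rewrite uval.
  by case/orP: k => /eqP k; [left|right]; apply: val_inj; rewrite /= k modn_small.
move=> c d _ _ ncd.
have : all (fun c => all (fun d => (c != d) ==>
    has (fun a => has (fun x => cov c a x && cov d a x) (iota 0 4)) (iota 0 4))
  (iota 0 7)) (iota 0 7) by [].
move=> /all_ord/(_ c)/all_ord/(_ d)/implyP/(_ ncd) hcd.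
have [a + {}hcd] := hasP hcd; have [x + /andP[cc cd]] := hasP hcd.
rewrite !mem_iota /= => x4 a4.
by exists (Ordinal a4), (Ordinal x4); split; apply: covP.
Qed.

Lemma achromatic3 : achromatic_index (johnson2 3) = 3.
Proof.
have ge : 3 <= achromatic_index (johnson2 3) by apply: (@achromatic_odd_ge 3).
have [|x [x0 hf _]] := @achromatic_smallest_class 3; first by lia.
by apply/eqP; rewrite eqn_leq ge andbT; move: hf; rewrite (_ : 'C(3, 2) * (3 - 2) = 3) //; nia.
Qed.

Lemma achromatic4 : achromatic_index (johnson2 4) = 7.
Proof.
have ge := achromatic4_ge.
have [|x [x0 hf hg]] := @achromatic_smallest_class 4; first by lia.
apply/eqP; rewrite eqn_leq ge andbT; move: hf hg; rewrite (_ : 'C(4, 2) * (4 - 2) = 12) //.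
by case: x x0 => [|[|x]] // _ hf hg; nia.
Qed.

Lemma achromatic5 : achromatic_index (johnson2 5) = 15.
Proof.
have ge : 15 <= achromatic_index (johnson2 5) by apply: (@achromatic_odd_ge 5).
have [|x [x0 hf hg]] := @achromatic_smallest_class 5; first by lia.
apply/eqP; rewrite eqn_leq ge andbT; move: hf hg; rewrite (_ : 'C(5, 2) * (5 - 2) = 30) //.
by case: x x0 => [|[|x]] // _ hf hg; nia.
Qed.

(** * The general bounds *)

Local Open Scope ring_scope.

Lemma achromatic_le_U (R : realType) n : (3 <= n)%N ->
  (1 < achromatic_index (johnson2 n))%N -> (achromatic_index (johnson2 n))%:Z <= U R n.
Proof. by move=> n3 /achromatic_smallest_class[x [x0 xf xg]]; apply: le_U x0 xf xg. Qed.

Lemma f_odd n : (3 <= n)%N -> odd n -> f n ((n%:Z - 1) %/ 2)%Z = n%:Z * (n%:Z - 2).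
Proof.
move=> n3 on; have := mul_bin_diag n 1; rewrite bin1 => b2.
have [h hE] : exists h, n = (2 * h + 1)%N by exists n./2; lia.
have -> : ((n%:Z - 1) %/ 2)%Z = h%:Z by lia.
rewrite /f (_ : 'C(n, 2)%:Z * (n%:Z - 2) = n%:Z * (n%:Z - 2) * h%:Z) ?mulzK; [|lia|].
  by [].
have -> : 'C(n, 2) = (n * h)%N by nia.
by nia.
Qed.

Lemma f_even n : (2 <= n)%N -> ~~ odd n -> f n (n%:Z %/ 2)%Z = n%:Z * (n%:Z - 3) + 2.
Proof.
move=> n2 on; have := mul_bin_diag n 1; rewrite bin1 => b2.
have [h hE] : exists h, n = (2 * h)%N by exists n./2; lia.
have -> : (n%:Z %/ 2)%Z = h%:Z by lia.
have bE : 'C(n, 2) = (h * n.-1)%N by nia.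
have -> : n%:Z * (n%:Z - 3) + 2 = n.-1%:Z * (n%:Z - 2) by nia.
rewrite /f (_ : 'C(n, 2)%:Z * (n%:Z - 2) = n.-1%:Z * (n%:Z - 2) * h%:Z) ?mulzK //; first by lia.
by rewrite bE; nia.
Qed.

Theorem corollary2p3 (R : realType) :
  [/\ achromatic_index (johnson2 3) = 3%N,
      achromatic_index (johnson2 4) = 7%N
    & achromatic_index (johnson2 5) = 15%N] /\
  [/\ forall n : nat, (7 <= n)%N -> odd n ->
        [/\ n%:Z * (n%:Z - 2) = f n ((n%:Z - 1) %/ 2)%Z,
            f n ((n%:Z - 1) %/ 2)%Z <= (achromatic_index (johnson2 n))%:Z
          & (achromatic_index (johnson2 n))%:Z <= U R n],
      forall n : nat, (6 <= n)%N -> ~~ odd n -> (n <> 0 %[mod 6])%N ->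
        [/\ n%:Z * (n%:Z - 3) + 2 = f n (n%:Z %/ 2)%Z,
            f n (n%:Z %/ 2)%Z <= (achromatic_index (johnson2 n))%:Z
          & (achromatic_index (johnson2 n))%:Z <= U R n]
    & forall n : nat, (6 <= n)%N -> (n = 0 %[mod 6])%N ->
        [/\ n%:Z * (n%:Z - 3) + 3 = f n (n%:Z %/ 2)%Z + 1,
            f n (n%:Z %/ 2)%Z + 1 <= (achromatic_index (johnson2 n))%:Z
          & (achromatic_index (johnson2 n))%:Z <= U R n]].
Proof.
split; first by split; [exact: achromatic3|exact: achromatic4|exact: achromatic5].
split=> n.
- move=> n7 on; rewrite f_odd //; last by lia.
  have ge := @achromatic_odd_ge n (ltn_trans (isT : (2 < 6)%N) n7) on.
  split=> //; first by lia.
  by apply: achromatic_le_U; nia.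
- move=> n6 on _; rewrite f_even //; last by lia.
  have ge := achromatic_even_ge2 n6 on.
  split=> //; first by lia.
  by apply: achromatic_le_U; nia.
move=> n6 n0; have on : ~~ odd n by lia.
have d6 : (6 %| n)%N by rewrite /dvdn n0.
rewrite f_even //; last by lia.
have ge := achromatic_even_ge3 n6 d6.
split; [by lia|by lia|].
by apply: achromatic_le_U; nia.
Qed.
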